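(* Let $N\ge1$, let $\lambda=(\lambda_1,\dots,\lambda_N)$ be a generalized partition, and let $\bar h_i(x^{\pm};\alpha)$ be defined by $$\frac{1-\alpha z}{\prod_{i=1}^N(1-x_iz)(1-x_i^{-1}z)}=\sum_{i\in\mathbb Z}\bar h_i(x^{\pm};\alpha)z^i .$$ Then the $BD$-interpolating Schur polynomial $s^{BD}_\lambda(x;\alpha)=\langle0|\Gamma_+(x^{\pm})\Gamma_+^{-1}(\alpha)|\lambda^{so}\rangle$ satisfies $$s^{BD}_\lambda(x;\alpha)=\det\big(\bar h_{\lambda_i-i+j}(x^{\pm};\alpha)+\bar h_{\lambda_i-i-j+1}(x^{\pm};\alpha)\big)_{1\le i,j\le N}.$$
   Context: A generalized partition is a weakly decreasing finite sequence of nonnegative integers (zeros allowed). $x=(x_1,\dots,x_N)$, $x^{\pm}=(x_1^{\pm1},\dots,x_N^{\pm1})$, $\alpha$ is a parameter, and $\bar h_n=0$ for $n<0$. Heisenberg algebra: generators $a_n$ ($n\in\mathbb Z\setminus\{0\}$) with $[a_m,a_n]=m\delta_{m,-n}$. The Fock space $\mathcal M$ is generated by the vacuum $|0\rangle$ with $a_n|0\rangle=0$ for $n>0$ (so $\mathcal M\cong\mathbb C[a_{-1},a_{-2},\dots]$), and $\langle 0|$ is the dual vacuum, a linear functional on $\mathcal M$ with $\langle 0|a_{-n}=0$ for $n>0$ and $\langle 0|1|0\rangle=1$. Vertex operator: $$U(z)=(1+z)\exp\Big(\sum_{n\ge1}\tfrac{a_{-n}}{n}z^n\Big)\exp\Big(-\sum_{n\ge1}\tfrac{a_n}{n}(z^n+z^{-n})\Big)=\sum_{n\in\mathbb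 Z}U_nz^{-n},$$ and $|\lambda^{so}\rangle=U_{-\lambda_1}\cdots U_{-\lambda_N}|0\rangle$. Half vertex operators: $\Gamma_+(z)=\exp\big(\sum_{n\ge1}\frac{a_n}{n}z^n\big)$, $\Gamma_+(x^{\pm})=\prod_{i=1}^N\Gamma_+(x_i)\Gamma_+(x_i^{-1})$. *)

(* Defs.v *)
From HB Require Import structures.
From mathcomp Require Import all_boot all_order all_algebra.
From mathcomp Require Import boolp classical_sets fsbigop.

Set Implicit Arguments.
Unset Strict Implicit.
Unset Printing Implicit Defensive.

Import Order.TTheory GRing.Theory Num.Theory.
Local Open Scope classical_set_scope.
Local Open Scope ring_scope.

(* In characteristic 0 these axioms determine the module up to isomorphism:
   it is K[a_{-1}, a_{-2}, ...], with a_{-n} acting by multiplication and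
   a_n by n d/da_{-n} for n > 0.  The generators are the [osc n] with n != 0;
   [osc 0] is unconstrained and is never used.  [fock_ind] says that the
   smallest subspace containing the vacuum and stable under the generators is
   everything, i.e. that the vacuum generates the module. *)
Record fockSpace (K : fieldType) := FockSpace {
  fock_sort :> lmodType K;
  osc : int -> {linear fock_sort -> fock_sort};
  vac : fock_sort;
  dvac : {scalar fock_sort};
  osc_comm : forall (m n : int) (v : fock_sort), m != 0 -> n != 0 ->
    osc m (osc n v) - osc n (osc m v) = (if m == - n then m%:~R else 0) *: v;
  osc_vac : forall n : int, 0 < n -> osc n vac = 0;
  fock_ind : forall P : fock_sort -> Prop,
    P vac ->
    (forall (c : K) u v, P u -> P v -> P (c *: u + v)) ->
    (forall (n : int) v, n != 0 -> P v -> P (osc n v)) ->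
    forall v, P v;
  dvac_osc : forall (n : int) (v : fock_sort), 0 < n -> dvac (osc (- n) v) = 0;
  dvac_vac : dvac vac = 1
}.

Arguments osc {K} f n.
Arguments vac {K} f.
Arguments dvac {K} f.

(* Formal distributions A(z) = \sum_n (A n) z^n in one variable z, with
   coefficients operators on M.  Infinite sums of operators are taken
   pointwise: \sum_(i \in D) f i is the sum of a finitely supported family
   (and 0 when the support is infinite).  On a Fock space every family summed
   below is finitely supported at each vector, because a vector is killed by
   all products of sufficiently many, or by any of sufficiently large index,
   of the annihilation operators osc n, n > 0. *)
Section FormalDistributions.
Variables (K : fieldType) (M : lmodType K).
Implicit Types A B : int -> M -> M.

Definition fd_one (n : int) (v : M) : M := if n == 0 then v else 0.

Definition fd_mul A B (n : int) (v : M) : M :=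
  \sum_(i \in [set: int]) A i (B (n - i) v).

Definition fd_exp A (n : int) (v : M) : M :=
  \sum_(m \in [set: nat]) (m`!%:R)^-1 *: iter m (fd_mul A) fd_one n v.

Definition op_exp (D : M -> M) (v : M) : M :=
  \sum_(m \in [set: nat]) (m`!%:R)^-1 *: iter m D v.

End FormalDistributions.

Section VertexOperators.
Variables (K : fieldType) (M : fockSpace K).

(* \sum_{n >= 1} (a_{-n} / n) z^n *)
Definition creation_series (n : int) (v : M) : M :=
  if 0 < n then (n%:~R)^-1 *: osc M (- n) v else 0.

(* - \sum_{n >= 1} (a_n / n) (z^n + z^{-n}) *)
Definition annihilation_series (n : int) (v : M) : M :=
  if n == 0 then 0 else - ((`|n|%:~R)^-1 *: osc M `|n| v).

Definition one_plus_z (n : int) (v : M) : M :=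
  if (n == 0) || (n == 1) then v else 0.

Definition vertexU : int -> M -> M :=
  fd_mul one_plus_z
    (fd_mul (fd_exp creation_series) (fd_exp annihilation_series)).

(* U(z) = \sum_n U_n z^{-n} *)
Definition Umode (n : int) : M -> M := vertexU (- n).

Definition so_vector (lambda : seq nat) : M :=
  foldr (fun (k : nat) v => Umode (- k%:Z) v) (vac M) lambda.

(* \sum_{n >= 1} (a_n / n) z^n, at a scalar z *)
Definition Gamma_exponent (z : K) (v : M) : M :=
  \sum_(n \in [set n : nat | (0 < n)%N]) (z ^+ n / n%:R) *: osc M n%:Z v.

Definition Gamma (z : K) : M -> M := op_exp (Gamma_exponent z).

(* The inverse of exp(D) is exp(- D). *)
Definition Gamma_inv (z : K) : M -> M :=
  op_exp (fun v => - Gamma_exponent z v).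

Definition Gamma_pm (N : nat) (x : 'I_N -> K) (v : M) : M :=
  foldr (fun i w => Gamma (x i) (Gamma ((x i)^-1) w)) v (enum 'I_N).

Definition sBD (N : nat) (lambda : N.-tuple nat) (x : 'I_N -> K) (alpha : K) :
  K := dvac M (Gamma_pm x (Gamma_inv alpha (so_vector lambda))).

End VertexOperators.

Arguments sBD {K} M {N} lambda x alpha.

Section GeneratingFunction.
Variables (K : fieldType) (N : nat) (x : 'I_N -> K) (alpha : K).

Definition hbar_denom : {poly K} :=
  \prod_(i < N) ((1 - x i *: 'X) * (1 - (x i)^-1 *: 'X)).

(* \sum_n (hbar n) z^n = (1 - alpha z) / hbar_denom as formal power series in
   z.  As hbar_denom has constant term 1, there is exactly one such hbar. *)
Definition is_hbar (hbar : int -> K) : Prop :=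
  (forall n : int, n < 0 -> hbar n = 0) /\
  (forall n : nat,
     \sum_(i < n.+1) hbar_denom`_i * hbar (n%:Z - i%:Z) = (1 - alpha *: 'X)`_n).

End GeneratingFunction.

(* Main.v *)
(* Write B(z) and H(z) for the annihilation and creation exponentials of the
   vertex operator, so that U(z) = (1 + z) H(z) B(z).  The commutation relation
   B(z) H(w) = (1 - z w)(1 - w / z) H(w) B(z), which also holds with U(w) in
   place of H(w), moves the B-factor of the first U through the others to the
   vacuum, which it fixes.  Its effect is a product of factors
   1 - (z + 1/z) S_j + S_j^2, where S_j shifts the index of the j-th mode.  On
   the other side, phi = <0| Gamma_+(x^{+-}) Gamma_+^{-1}(alpha) sends H_n v to
   hbar_n phi(v).  By induction on the number of modes, phi of the remaining
   modes is a determinant whose rows have entries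
   c_j = hbar_(l + j) + hbar_(l - j - 1).  The factors act on these rows by
   c_j |-> c_(j+1) - (z + 1/z) c_j + c_(j-1), which is also the effect of a
   column operation on the determinant with one more row. *)

Require Import Defs.
From HB Require Import structures.
From mathcomp Require Import all_boot all_order all_algebra.
From mathcomp Require Import boolp classical_sets functions fsbigop.
From mathcomp Require Import perm zify ring.

Set Implicit Arguments.
Unset Strict Implicit.
Unset Printing Implicit Defensive.

Import Order.TTheory GRing.Theory Num.Theory.
Local Open Scope classical_set_scope.
Local Open Scope ring_scope.

Definition lin_of (R : pzRingType) (U V : lmodType R) (f : U -> V)
    (fL : linear f) : {linear U -> V} :=
  HB.pack f (GRing.isLinear.Build R U V *:%R f fL).

Lemma linear_fun0 (R : pzRingType) (U V : lmodType R) (f : U -> V) :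
  linear f -> f 0 = 0.
Proof. by move=> fL; exact: (linear0 (lin_of fL)). Qed.

(** * Sums of finitely supported families *)

Section FiniteSupport.
Variables (I : choiceType) (V : nmodType).
Implicit Types (f g : I -> V) (s : seq I).

(** A sum over [[set: I]] is 0 by convention when the support is infinite, so its additivity has to
    be derived under this condition. *)
Definition finsupp f := exists s, forall i, i \notin s -> f i = 0.

Lemma fsumE s f : uniq s -> (forall i, i \notin s -> f i = 0) ->
  \sum_(i \in [set: I]) f i = \sum_(i <- s) f i.
Proof.
move=> s_uniq fs; rewrite (fsbigE s) //; last by move=> i _; exact: fs.
by apply: eq_bigl => i; rewrite in_setT.
Qed.

Lemma finsuppD f g : finsupp f -> finsupp g -> finsupp (fun i => f i + g i).
Proof.
move=> [s fs] [t gt]; exists (s ++ t) => i.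
by rewrite mem_cat negb_or => /andP[/fs-> /gt->]; rewrite addr0.
Qed.

Lemma finsupp_sum N (f : 'I_N -> I -> V) : (forall j, finsupp (f j)) ->
  finsupp (fun i => \sum_j f j i).
Proof.
elim: N f => [|N IHN] f ff; first by exists [::] => i _; rewrite big_ord0.
have := finsuppD (ff ord0) (IHN _ (fun j => ff (lift ord0 j))).
by move=> [s fs]; exists s => i /fs; rewrite big_ord_recl.
Qed.

Lemma fsumD f g : finsupp f -> finsupp g ->
  \sum_(i \in [set: I]) (f i + g i) =
  \sum_(i \in [set: I]) f i + \sum_(i \in [set: I]) g i.
Proof.
move=> [s fs] [t gt]; pose r := undup (s ++ t).
have fr i : i \notin r -> f i = 0.
  by rewrite mem_undup mem_cat negb_or => /andP[/fs].
have gr i : i \notin r -> g i = 0.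
  by rewrite mem_undup mem_cat negb_or => /andP[_ /gt].
rewrite !(@fsumE r) ?undup_uniq ?big_split //.
by move=> i ir; rewrite fr // gr // addr0.
Qed.

Lemma fsum_delta (j : I) f : \sum_(i \in [set: I]) (if i == j then f i else 0) = f j.
Proof.
rewrite (@fsumE [:: j]) ?big_seq1 ?eqxx // => i.
by rewrite inE => /negPf->.
Qed.

(** An infinite support is harmless: the sum is then 0, which [P 0] covers. *)
Lemma fsum_closed (A : set I) (P : V -> Prop) f : P 0 ->
  (forall u v, P u -> P v -> P (u + v)) -> (forall i, A i -> P (f i)) ->
  P (\sum_(i \in A) f i).
Proof.
move=> P0 PD Pf; case: finite_supportP => [_|X XA _ _]; first by rewrite big_nil.
by rewrite big_seq; elim/big_ind: _ => // i iX; apply/Pf/XA.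
Qed.

End FiniteSupport.

Lemma fsum_raddf (I : choiceType) (U V : nmodType) (h : {additive U -> V})
    (f : I -> U) : finsupp f ->
  h (\sum_(i \in [set: I]) f i) = \sum_(i \in [set: I]) h (f i).
Proof.
move=> [s fs]; rewrite !(@fsumE _ _ (undup s)) ?undup_uniq ?raddf_sum //.
  by move=> i; rewrite mem_undup => /fs->; rewrite raddf0.
by move=> i; rewrite mem_undup; exact: fs.
Qed.

Lemma finsupp_raddf (I : choiceType) (U V : nmodType) (h : {additive U -> V})
    (f : I -> U) : finsupp f -> finsupp (h \o f).
Proof. by move=> [s fs]; exists s => i /fs /= ->; rewrite raddf0. Qed.

Lemma fsumP (K : pzRingType) (I : choiceType) (V : lmodType K) (c : K)
    (f g : I -> V) : finsupp f -> finsupp g ->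
  \sum_(i \in [set: I]) (c *: f i + g i) =
  c *: (\sum_(i \in [set: I]) f i) + \sum_(i \in [set: I]) g i.
Proof.
move=> ff fg; rewrite fsumD // ?(fsum_raddf (c \*: idfun)) //.
exact: (finsupp_raddf (c \*: idfun)).
Qed.

Lemma finsuppN (I : choiceType) (V : zmodType) (f : I -> V) :
  finsupp f -> finsupp (fun i => - f i).
Proof. exact: (@finsupp_raddf _ _ _ -%R). Qed.

Lemma fsumN (I : choiceType) (V : zmodType) (f : I -> V) : finsupp f ->
  \sum_(i \in [set: I]) - f i = - \sum_(i \in [set: I]) f i.
Proof. by move=> fs; rewrite (fsum_raddf -%R). Qed.

Lemma finsuppB (I : choiceType) (V : zmodType) (f g : I -> V) :
  finsupp f -> finsupp g -> finsupp (fun i => f i - g i).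
Proof. by move=> ff /finsuppN gf; exact: finsuppD. Qed.

Lemma fsumB (I : choiceType) (V : zmodType) (f g : I -> V) :
  finsupp f -> finsupp g -> \sum_(i \in [set: I]) (f i - g i) =
  \sum_(i \in [set: I]) f i - \sum_(i \in [set: I]) g i.
Proof. by move=> ff gf; rewrite fsumD ?fsumN //; exact: finsuppN. Qed.

Lemma finsupp_int (V : nmodType) (R : nat) (f : int -> V) :
  (forall i : int, (R < absz i)%N -> f i = 0) -> finsupp f.
Proof.
move=> fR; exists ([seq i%:Z | i <- iota 0 R.+1] ++ [seq - i%:Z | i <- iota 0 R.+1]).
move=> i iN; apply: fR; rewrite ltnNge; apply: contra iN => iR.
rewrite mem_cat; case: i iR => i iR; apply/orP; [left|right]; apply/mapP.
  by exists i; rewrite ?mem_iota.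
by exists i.+1; rewrite ?mem_iota // NegzE.
Qed.

Lemma finsupp_shift (V : nmodType) (e : int -> V) (j : int) :
  finsupp e -> finsupp (fun m => e (m + j)).
Proof.
move=> [s es]; exists [seq m - j | m <- s] => m ms; apply: es.
by apply: contra ms => ms; apply/mapP; exists (m + j); rewrite ?addrK.
Qed.

Lemma finsupp_nat (V : nmodType) (R : nat) (f : nat -> V) :
  (forall i, (R <= i)%N -> f i = 0) -> finsupp f.
Proof.
by move=> fR; exists (iota 0 R) => i; rewrite mem_iota add0n -leqNgt; exact: fR.
Qed.

Lemma finsupp_natP (V : nmodType) (f : nat -> V) :
  finsupp f -> exists R, forall i, (R <= i)%N -> f i = 0.
Proof.
move=> [s fs]; exists (\max_(i <- s) i).+1 => i; rewrite ltnNge => si.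
by apply: fs; apply: contra si => si; exact: (@leq_bigmax_seq _ _ xpredT id).
Qed.

Lemma fsum_nat (V : nmodType) (R : nat) (f : nat -> V) :
  (forall i, (R <= i)%N -> f i = 0) ->
  \sum_(i \in [set: nat]) f i = \sum_(i < R) f i.
Proof.
move=> fR; rewrite (@fsumE _ _ (iota 0 R)) ?iota_uniq.
- by rewrite -[RHS](big_mkord xpredT) /index_iota subn0.
- by [].
by move=> i; rewrite mem_iota add0n -leqNgt; exact: fR.
Qed.

(** * Exponential series of a sequence of vectors *)

Section ExpSum.
Variables (K : fieldType) (charK : [pchar K] =i pred0) (V : lmodType K).
Implicit Types y : nat -> V.

Definition exp_sum y : V := \sum_(m \in [set: nat]) (m`!%:R)^-1 *: y m.

Lemma finsupp_exp y : finsupp y -> finsupp (fun m => (m`!%:R)^-1 *: y m).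
Proof. by move=> [s ys]; exists s => i /ys->; rewrite scaler0. Qed.

Lemma exp_sumP y (c : K) (z : nat -> V) : finsupp y -> finsupp z ->
  exp_sum (fun m => c *: y m + z m) = c *: exp_sum y + exp_sum z.
Proof.
move=> /finsupp_exp ys /finsupp_exp zs.
rewrite /exp_sum (fsum_raddf (c \*: idfun)) // -fsumD //; last first.
  exact: (finsupp_raddf (c \*: idfun)).
by apply: eq_fsbigr => m _ /=; rewrite scalerDr !scalerA mulrC.
Qed.

Lemma exp_sumD y (z : nat -> V) : finsupp y -> finsupp z ->
  exp_sum (fun m => y m + z m) = exp_sum y + exp_sum z.
Proof.
move=> ys zs; rewrite -[exp_sum y]scale1r -exp_sumP //.
by congr exp_sum; apply/funext => m; rewrite scale1r.
Qed.

Lemma exp_sum0 y : (forall m, y m.+1 = 0) -> exp_sum y = y 0.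
Proof.
move=> y0; rewrite /exp_sum (@fsum_nat _ 1) ?big_ord1 ?fact0 ?invr1 ?scale1r //.
by case=> // m _; rewrite y0 scaler0.
Qed.

Lemma natrS_neq0 n : (n.+1%:R : K) != 0.
Proof. by move/pcharf0P: charK => ->. Qed.

(** The analogue of exp' = exp, from m/m! = 1/(m-1)!. At m = 0 the coefficient kills the truncated
    [m.-1]. *)
Lemma exp_sum_deriv y : finsupp y ->
  exp_sum (fun m => m%:R *: y m.-1) = exp_sum y.
Proof.
move=> /finsupp_natP[R yR].
rewrite /exp_sum (@fsum_nat _ R.+1) => [|[|m] mR /=].
- rewrite (@fsum_nat _ R) => [|m mR]; last by rewrite yR ?scaler0.
  rewrite big_ord_recl /= scale0r scaler0 add0r; apply: eq_bigr => m _ /=.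
  rewrite /bump /= add1n factS natrM invfM scalerA.
  by rewrite mulrAC mulVf ?mul1r // natrS_neq0.
- by rewrite scale0r scaler0.
by rewrite yR ?scaler0.
Qed.

Lemma linear_exp_sum (h : {linear V -> V}) y : finsupp y ->
  h (exp_sum y) = exp_sum (h \o y).
Proof.
move=> /finsupp_exp ys; rewrite /exp_sum fsum_raddf //.
by apply: eq_fsbigr => m _; exact: linearZ.
Qed.

Lemma exp_sum_ord N (f : 'I_N -> nat -> V) :
  (forall i, finsupp (f i)) ->
  exp_sum (fun m => \sum_i f i m) = \sum_i exp_sum (f i).
Proof.
elim: N f => [|N IHN] f ff.
  rewrite big_ord0 exp_sum0 ?big_ord0 // => m; exact: big_ord0.
rewrite big_ord_recl -IHN // -exp_sumD //.
  by congr exp_sum; apply/funext => m; rewrite big_ord_recl.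
exact: (finsupp_sum (fun i => ff (lift ord0 i))).
Qed.

End ExpSum.

(** * The grading of the Fock space *)

Section FockSpace.
Variables (K : fieldType) (M : fockSpace K).
Implicit Types (v w : M) (k d e : nat).

(** With the shift by one, [cr k] and [an k] for k >= 0 run over exactly the generators. *)
Notation cr k := (osc M (- k.+1%:Z)).
Notation an k := (osc M k.+1%:Z).

Lemma an_cr i k v :
  an i (cr k v) = cr k (an i v) + (if i == k then k.+1%:R else 0) *: v.
Proof.
have := @osc_comm K M i.+1%:Z (- k.+1%:Z) v isT isT.
rewrite opprK eqz_nat eqSS => /eqP; rewrite subr_eq => /eqP ->.
by rewrite addrC; case: eqP => [->|_].
Qed.

Lemma cr_cr i k v : cr i (cr k v) = cr k (cr i v).
Proof.
have := @osc_comm K M (- i.+1%:Z) (- k.+1%:Z) v isT isT.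
by rewrite scale0r => /subr0_eq.
Qed.

Inductive creation_span : M -> Prop :=
| creation_vac : creation_span (vac M)
| creation_lin c u v :
    creation_span u -> creation_span v -> creation_span (c *: u + v)
| creation_osc k v : creation_span v -> creation_span (cr k v).

(** The span is stable under each [an k] as well: moved to the right past creation operators it
    leaves scalars, and it kills the vacuum. So [fock_ind] applies. *)
Lemma creation_spanP v : creation_span v.
Proof.
have span0 : creation_span 0.
  by rewrite -(addNr (vac M)) -scaleN1r; apply: creation_lin; exact: creation_vac.
elim/fock_ind: v => [|c u v Su Sv|[[|k]|k] v //= _ Sv].
- exact: creation_vac.
- exact: creation_lin.
- elim: Sv => {v} [|c u v _ Su _ Sv|j v Sv Skv].
  + by rewrite osc_vac.
  + by rewrite linearP; exact: creation_lin.
  rewrite an_cr addrC; apply: creation_lin => //; exact: creation_osc.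
by rewrite NegzE; exact: creation_osc.
Qed.

Lemma fock_creation_ind (P : M -> Prop) : P (vac M) ->
  (forall c u v, P u -> P v -> P (c *: u + v)) ->
  (forall k v, P v -> P (cr k v)) -> forall v, P v.
Proof. by move=> P0 PD Pcr v; elim: (creation_spanP v) => *; auto. Qed.

Definition weight (s : seq nat) := sumn (map S s).
Definition annihilate v s := foldl (fun w i => an i w) v s.
(* [lowered d e v]: [v] lies in degree at most [d - e] for the grading in which
   a_{-n} has degree n (and [v = 0] if [d < e]). *)
Definition lowered d e v :=
  forall s, (d < e + weight s)%N -> annihilate v s = 0.

Lemma annihilateP c v w s :
  annihilate (c *: v + w) s = c *: annihilate v s + annihilate w s.
Proof. by elim: s v w => //= i s IHs v w; rewrite linearP IHs. Qed.

Lemma annihilate0 s : annihilate 0 s = 0.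
Proof. by elim: s => //= i s; rewrite linear0. Qed.

Lemma lowered_lt d e v : (d < e)%N -> lowered d e v -> v = 0.
Proof. by move=> de /(_ [::]); apply; rewrite addn0. Qed.

Lemma lowered0 d e : lowered d e 0.
Proof. by move=> s _; exact: annihilate0. Qed.

Lemma loweredP d e c v w :
  lowered d e v -> lowered d e w -> lowered d e (c *: v + w).
Proof.
by move=> lv lw s ds; rewrite annihilateP lv // lw // scaler0 addr0.
Qed.

Lemma loweredZ d e c v : lowered d e v -> lowered d e (c *: v).
Proof. by move=> lv; rewrite -[c *: v]addr0; apply: loweredP => //; exact: lowered0. Qed.

Lemma loweredD d e v w :
  lowered d e v -> lowered d e w -> lowered d e (v + w).
Proof. by move=> lv lw; rewrite -[v]scale1r; exact: loweredP. Qed.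

Lemma lowered_an d e i v : lowered d e v -> lowered d (e + i.+1) (an i v).
Proof. by move=> lv s ds; apply: (lv (i :: s)); rewrite /weight /= addnA. Qed.

Lemma lowered_le d d' e e' v : (d <= d')%N -> (e' <= e)%N ->
  lowered d e v -> lowered d' e' v.
Proof.
move=> dd' ee' lv s ds; apply: lv; apply: leq_ltn_trans dd' _.
by apply: leq_trans ds _; rewrite leq_add2r.
Qed.

Lemma lowered_vac : lowered 0 0 (vac M).
Proof. by case=> // i s _ /=; rewrite osc_vac // annihilate0. Qed.

(** Induction on the word [s]: commuting its first letter past [cr k] leaves a term with [v] lowered
    and, for equal indices, a multiple of [v]. *)
Lemma lowered_cr d k v : lowered d 0 v -> lowered (d + k.+1) 0 (cr k v).
Proof.
move=> lv s; rewrite add0n; elim: s d v lv => [|i s IHs] d v lv //=.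
rewrite /weight /= -/(weight s) => ds.
rewrite an_cr addrC annihilateP addrC.
have -> : annihilate (cr k (an i v)) s = 0.
  have := lowered_an (i := i) lv; rewrite add0n => liv.
  (* If d < i + 1 then [an i v] is already 0; otherwise the subtraction [d - i.+1] does not
     truncate. *)
  have [di|id_] := ltnP d i.+1.
    by rewrite (lowered_lt di liv) linear0 annihilate0.
  apply: (IHs (d - i.+1)%N); last by lia.
  by move=> t dt; apply: liv; lia.
case: eqP => [ik|_]; last by rewrite scale0r addr0.
by rewrite lv ?scaler0 ?addr0 //; lia.
Qed.

(** This bound makes the series in annihilation operators finite at each vector. *)
Lemma lowered_exists v : exists d, lowered d 0 v.
Proof.
elim/fock_creation_ind: v => [|c u v [d lu] [e lv]|k v [d lv]].
- by exists 0%N; exact: lowered_vac.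
- exists (maxn d e); apply: loweredP.
    by apply: lowered_le lu; lia.
  by apply: lowered_le lv; lia.
by exists (d + k.+1)%N; exact: lowered_cr.
Qed.

End FockSpace.

(** * Half vertex operators *)

Section Vertex.
Variables (K : fieldType) (charK : [pchar K] =i pred0) (M : fockSpace K).
Implicit Types (v w : M) (k d e m : nat) (n : int).

Notation cr k := (osc M (- k.+1%:Z)).
Notation an k := (osc M k.+1%:Z).

(** * Exponentials of operators with scalar commutators *)

Section ExpOperator.
Variables (D : M -> M) (c : nat -> K).
Hypothesis D_linear : linear D.
Hypothesis D_vac : D (vac M) = 0.
Hypothesis D_lowered : forall d e v, lowered d e v -> lowered d e.+1 (D v).
Hypothesis D_cr : forall k v, D (cr k v) = cr k (D v) + c k *: v.

Lemma iter_linear m : linear (iter m D).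
Proof. by elim: m => //= m IHm a u v /=; rewrite IHm D_linear. Qed.

Lemma finsupp_iter v : finsupp (fun m => iter m D v).
Proof.
have [d lv] := lowered_exists v; apply: (@finsupp_nat _ d.+1) => m dm.
apply: (lowered_lt dm); elim: m {dm} => //= m; exact: D_lowered.
Qed.

Lemma op_exp_linear : linear (op_exp D).
Proof.
move=> a u v; rewrite -[RHS]exp_sumP; try exact: finsupp_iter.
by congr exp_sum; apply/funext => m; rewrite iter_linear.
Qed.

Lemma op_exp_vac : op_exp D (vac M) = vac M.
Proof.
apply: (@exp_sum0 K M) => m; rewrite iterSr D_vac.
exact: (linear_fun0 (iter_linear m)).
Qed.

Lemma iter_cr m k v :
  iter m D (cr k v) = cr k (iter m D v) + (m%:R * c k) *: iter m.-1 D v.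
Proof.
elim: m => [|m IHm] /=; first by rewrite mul0r scale0r addr0.
rewrite IHm addrC D_linear addrC D_cr -addrA; congr (_ + _).
case: m {IHm} => [|m]; first by rewrite mul0r scale0r addr0 mul1r.
by rewrite /= -scalerDl -[m.+2]add1n natrD mulrDl mul1r.
Qed.

(** As [D, cr k] = c k is a scalar, [D^m, cr k] = m (c k) D^(m-1); summing over m, conjugation by
    exp(D) adds c k to [cr k]. *)
Lemma op_exp_cr k v : op_exp D (cr k v) = cr k (op_exp D v) + c k *: op_exp D v.
Proof.
have iv := finsupp_iter v.
transitivity (exp_sum (fun m => cr k (iter m D v) +
                                c k *: (m%:R *: iter m.-1 D v))).
  by congr exp_sum; apply/funext => m; rewrite iter_cr scalerA mulrC.
have iv' : finsupp (fun m => m%:R *: iter m.-1 D v).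
  have /finsupp_natP[R vR] := iv; apply: (@finsupp_nat _ R.+1) => -[|m] // mR.
  by rewrite vR ?scaler0.
rewrite exp_sumD; last exact: (finsupp_raddf (c k \*: idfun)).
  congr (_ + _); first exact: (esym (linear_exp_sum (cr k) iv)).
  rewrite -(linear_exp_sum (c k \*: idfun)) //=.
  by rewrite exp_sum_deriv.
exact: (finsupp_raddf (cr k)).
Qed.

End ExpOperator.

Lemma Gamma_exponentE (x : K) d v : lowered d 0 v ->
  Gamma_exponent x v = \sum_(i < d) (x ^+ i.+1 / i.+1%:R) *: an i v.
Proof.
move=> lv; rewrite /Gamma_exponent (fsbigE (iota 1 d)) ?iota_uniq //=.
- rewrite big_seq_cond (eq_bigl (fun i => i \in iota 1 d)) -?big_seq; last first.
    move=> i; rewrite mem_iota; apply/andP/idP => [[]//|i1]; split=> //.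
    by rewrite inE /=; case/andP: i1.
  transitivity (\sum_(0 <= i < d) (x ^+ i.+1 / i.+1%:R) *: an i v).
    by rewrite -[1%N]addn0 iotaDl big_map /index_iota subn0.
  exact: (big_mkord xpredT).
- by move=> i /=; rewrite mem_iota => /andP[].
case=> // i _; rewrite mem_iota add1n ltnS -leqNgt => di.
by rewrite (lowered_lt _ (lowered_an lv)) ?scaler0.
Qed.

Lemma Gamma_exponent_linear (x : K) : linear (@Gamma_exponent K M x).
Proof.
move=> a u v.
have [d lu] := lowered_exists u; have [e lv] := lowered_exists v.
have lu' := lowered_le (leq_maxl d e) (leqnn 0) lu.
have lv' := lowered_le (leq_maxr d e) (leqnn 0) lv.
rewrite !(@Gamma_exponentE x (maxn d e)) //; last exact: loweredP.
rewrite scaler_sumr -big_split; apply: eq_bigr => i _ /=.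
by rewrite linearP scalerDr !scalerA mulrC.
Qed.

Lemma Gamma_exponent_vac (x : K) : Gamma_exponent x (vac M) = 0.
Proof. by rewrite /Gamma_exponent fsbig1 // => i i0; rewrite osc_vac ?scaler0. Qed.

Lemma Gamma_exponent_lowered (x : K) d e v :
  lowered d e v -> lowered d e.+1 (Gamma_exponent x v).
Proof.
move=> lv; apply: fsum_closed => [|u w|[|i] // _]; first exact: lowered0.
  exact: loweredD.
by apply/loweredZ/(lowered_le _ _ (lowered_an (i := i) lv)); lia.
Qed.

(** Only a_(k+1) fails to commute with [cr k], and the commutator k + 1 cancels the denominator of
    its coefficient. *)
Lemma Gamma_exponent_cr (x : K) k v :
  Gamma_exponent x (cr k v) = cr k (Gamma_exponent x v) + x ^+ k.+1 *: v.
Proof.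
have [d lv] := lowered_exists v.
rewrite (@Gamma_exponentE x (d + k.+1)); last exact: lowered_cr.
(* The bound for [cr k v] is used for [v] too, so that both sums have the same range. *)
rewrite (@Gamma_exponentE x (d + k.+1) v); last first.
  by apply: lowered_le lv; rewrite ?leq_addr.
rewrite linear_sum /=.
under eq_bigr => i _ do rewrite an_cr scalerDr.
rewrite big_split; congr (_ + _); first by apply: eq_bigr => i _; rewrite linearZ.
have kd : (k < d + k.+1)%N by lia.
rewrite (bigD1 (Ordinal kd)) //= eqxx big1 ?addr0.
  by rewrite scalerA divfK ?(natrS_neq0 charK).
move=> i ik; rewrite ifF ?scale0r ?scaler0 //.
by apply: contraNF ik => /eqP ik; apply/eqP/val_inj.
Qed.

Lemma Gamma_linear (x : K) : linear (@Gamma K M x).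
Proof.
by apply: op_exp_linear;
  [exact: Gamma_exponent_linear | exact: Gamma_exponent_lowered].
Qed.

Lemma Gamma_vac (x : K) : Gamma x (vac M) = vac M.
Proof.
by apply: op_exp_vac; [exact: Gamma_exponent_linear | exact: Gamma_exponent_vac].
Qed.

Lemma Gamma_cr (x : K) k v : Gamma x (cr k v) =
  cr k (Gamma x v) + x ^+ k.+1 *: Gamma x v.
Proof.
apply: (op_exp_cr (c := fun k => x ^+ k.+1)) => [|d e u|j u].
- exact: Gamma_exponent_linear.
- exact: Gamma_exponent_lowered.
- exact: Gamma_exponent_cr.
Qed.

Lemma Gamma_inv_exponent_linear (x : K) : linear (fun v : M => - Gamma_exponent x v).
Proof. by move=> a u v; rewrite Gamma_exponent_linear opprD scalerN. Qed.

Lemma Gamma_inv_exponent_lowered (x : K) d e v :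
  lowered d e v -> lowered d e.+1 (- Gamma_exponent x v).
Proof. by move=> lv; rewrite -scaleN1r; apply/loweredZ/Gamma_exponent_lowered. Qed.

Lemma Gamma_inv_linear (x : K) : linear (@Gamma_inv K M x).
Proof.
by apply: op_exp_linear;
  [exact: Gamma_inv_exponent_linear | exact: Gamma_inv_exponent_lowered].
Qed.

Lemma Gamma_inv_vac (x : K) : Gamma_inv x (vac M) = vac M.
Proof.
apply: op_exp_vac; first exact: Gamma_inv_exponent_linear.
by rewrite Gamma_exponent_vac oppr0.
Qed.

Lemma Gamma_inv_cr (x : K) k v :
  Gamma_inv x (cr k v) = cr k (Gamma_inv x v) - x ^+ k.+1 *: Gamma_inv x v.
Proof.
rewrite -scaleNr; apply: (op_exp_cr (c := fun k => - x ^+ k.+1)) => [|d e u|j u].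
- exact: Gamma_inv_exponent_linear.
- exact: Gamma_inv_exponent_lowered.
- by rewrite Gamma_exponent_cr opprD linearN scaleNr.
Qed.

End Vertex.

(** * Modes of the annihilation exponential *)

Section Annihilation.
Variables (K : fieldType) (charK : [pchar K] =i pred0) (M : fockSpace K).
Implicit Types (v w : M) (k d e m : nat) (n i : int).

Notation cr k := (osc M (- k.+1%:Z)).
Notation an k := (osc M k.+1%:Z).

(** At i = 0 the truncated index [(absz i).-1] is harmless, as the coefficient is 0. *)
Lemma annihilation_seriesE i v : annihilation_series i v =
  (if i == 0 then 0 else - ((absz i)%:R)^-1) *: an (absz i).-1 v.
Proof.
rewrite /annihilation_series; case: eqP => [->|/eqP i0]; first by rewrite scale0r.
by rewrite scaleNr -abszE prednK ?absz_gt0.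
Qed.

Lemma annihilation_series_linear i : linear (@annihilation_series K M i).
Proof.
by move=> a u v; rewrite !annihilation_seriesE linearP scalerDr !scalerA mulrC.
Qed.

Lemma annihilation_series0 i : annihilation_series i (0 : M) = 0.
Proof. exact: (linear0 (lin_of (annihilation_series_linear i))). Qed.

Lemma annihilation_series_cr i k v : annihilation_series i (cr k v) =
  cr k (annihilation_series i v) + (if absz i == k.+1 then - v else 0).
Proof.
rewrite !annihilation_seriesE an_cr scalerDr; congr (_ + _); first by rewrite linearZ_LR.
case: eqP => [->|/eqP i0]; first by rewrite scale0r.
rewrite -(prednK (n := absz i)) ?absz_gt0 //= eqSS; case: eqP => [->|_].
  by rewrite scalerA mulNr mulVf ?(natrS_neq0 charK) // scaleN1r.
by rewrite scale0r scaler0.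
Qed.

Definition annpow m : int -> M -> M :=
  iter m (fd_mul (@annihilation_series K M)) (@fd_one K M).

Lemma annpowS m n v :
  annpow m.+1 n v = \sum_(i \in [set: int]) annihilation_series i (annpow m (n - i) v).
Proof. by []. Qed.

(** The factor of index i lowers the degree by |i| >= 1, and the m indices add up to n; hence both
    bounds. *)
Lemma annpow_lowered d m n v : lowered d 0 v -> lowered d (maxn (absz n) m) (annpow m n v).
Proof.
move=> lv; elim: m n => [|m IHm] n.
  rewrite /annpow /= /fd_one; case: eqP => [->//|_]; exact: lowered0.
rewrite annpowS; apply: fsum_closed; [exact: lowered0 | exact: loweredD |].
move=> i _; rewrite annihilation_seriesE; case: eqP => [_|/eqP i0].
  by rewrite scale0r; exact: lowered0.
by apply: loweredZ; apply: (lowered_le (leqnn d) _ (lowered_an (IHm (n - i)))); lia.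
Qed.

Lemma annpow_eq0 d m n v : lowered d 0 v -> (d < maxn (absz n) m)%N -> annpow m n v = 0.
Proof. by move=> lv dnm; exact: lowered_lt dnm (annpow_lowered lv). Qed.

Lemma finsupp_annpow v n : finsupp (fun m => annpow m n v).
Proof.
have [d lv] := lowered_exists v; apply: (@finsupp_nat _ d.+1) => m dm.
by apply: (annpow_eq0 lv); lia.
Qed.

Lemma finsupp_annpowS m n v :
  finsupp (fun i => annihilation_series i (annpow m (n - i) v)).
Proof.
have [d lv] := lowered_exists v; apply: (@finsupp_int _ (d + absz n)) => i di.
by rewrite (annpow_eq0 lv) ?annihilation_series0 //; lia.
Qed.

Lemma annpow_linear m n : linear (annpow m n).
Proof.
elim: m n => [|m IHm] n a u v.
  by rewrite /annpow /= /fd_one; case: eqP; rewrite ?scaler0 ?addr0.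
rewrite !annpowS -fsumP; try exact: finsupp_annpowS.
by apply: eq_fsbigr => i _; rewrite IHm annihilation_series_linear.
Qed.

(** The exponent A(z) of B(z) satisfies [A(z), cr k] = -(z^(k+1) + z^(-k-1)), a scalar series; this
    is the resulting Leibniz rule for A(z)^m. *)
Lemma annpow_cr m n k v : annpow m n (cr k v) = cr k (annpow m n v) +
  (- m%:R) *: (annpow m.-1 (n - k.+1%:Z) v + annpow m.-1 (n + k.+1%:Z) v).
Proof.
elim: m n => [|m IHm] n.
  rewrite oppr0 scale0r addr0 /annpow /= /fd_one; case: eqP => //=.
  by rewrite linear0.
(* [f] has [cr k] moved past all factors, [g] is the commutator with the first factor, and [h] comes
   from the commutators with the other m. *)
pose f i := annihilation_series i (annpow m (n - i) v).
pose g (c : int) i := if i == c then - annpow m (n - i) v else 0.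
pose h (c : int) i := annihilation_series i (annpow m.-1 (n + c - i) v).
have fg c : finsupp (g c).
  exists [:: c] => i; rewrite inE /g; by move/negPf->.
transitivity (\sum_(i \in [set: int]) (cr k (f i) +
   ((g k.+1%:Z i + g (- k.+1%:Z) i) + ((- m%:R) *: (h (- k.+1%:Z) i + h k.+1%:Z i))))).
  rewrite annpowS; apply: eq_fsbigr => i _; rewrite IHm.
  rewrite addrC annihilation_series_linear annihilation_series_cr -/(f i) addrC -addrA.
  congr (_ + (_ + _)).
    rewrite /g; case: eqP => [ik|ik]; last by rewrite !ifF ?addr0 //; apply/eqP; lia.
    have [->|->] : i = k.+1%:Z \/ i = - k.+1%:Z by lia.
      by do 2 case: eqP => [] *; rewrite ?addr0 ?add0r //; lia.
    by do 2 case: eqP => [] *; rewrite ?addr0 ?add0r //; lia.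
  have aD (u w : M) :
      annihilation_series i (u + w) = annihilation_series i u + annihilation_series i w.
    exact: (linearD (lin_of (annihilation_series_linear i))).
  by rewrite aD /h ![n + _ - i]addrAC.
have fh : finsupp (fun i => h (- k.+1%:Z) i + h k.+1%:Z i).
  by apply: finsuppD; exact: finsupp_annpowS.
have fmh := finsupp_raddf (- m%:R \*: idfun) fh.
rewrite fsumD; last 2 first.
- exact: (finsupp_raddf (cr k)) (finsupp_annpowS _ _ _).
- by apply: finsuppD => //; exact: finsuppD.
rewrite -(fsum_raddf (cr k)); last exact: finsupp_annpowS.
congr (_ + _); rewrite fsumD //; last exact: finsuppD.
rewrite fsumD // !fsum_delta opprK -(fsum_raddf (- m%:R \*: idfun)) //=.
rewrite fsumD; try exact: finsupp_annpowS.
rewrite -!annpowS -opprD -scaleN1r.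
(* For m = 0 the part from [h] has coefficient 0; otherwise the multiplicities 1 and m add up. *)
case: m {IHm f g h fg fh fmh} => [|m]; first by rewrite oppr0 scale0r addr0.
by rewrite prednK // -scalerDl -opprD -[m.+2]add1n natrD.
Qed.

Definition bmode n : M -> M := fd_exp (@annihilation_series K M) n.

Lemma bmode_linear n : linear (bmode n).
Proof.
move=> a u v; rewrite -[RHS]exp_sumP; try exact: finsupp_annpow.
by congr exp_sum; apply/funext => m; exact: annpow_linear.
Qed.

HB.instance Definition _ n :=
  GRing.isLinear.Build K M M *:%R (bmode n) (bmode_linear n).

Lemma bmode_vac n : bmode n (vac M) = (n == 0)%:R *: vac M.
Proof.
transitivity (annpow 0 n (vac M)).
  apply: (@exp_sum0 K M (fun m => annpow m n (vac M))) => m.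
  by apply: (annpow_eq0 (lowered_vac M)); lia.
by rewrite /annpow /= /fd_one; case: eqP; rewrite ?scale1r ?scale0r.
Qed.

Lemma finsupp_bmode v : exists R, forall n, (R < absz n)%N -> bmode n v = 0.
Proof.
have [d lv] := lowered_exists v; exists d => n dn.
rewrite [LHS](@exp_sum0 K M (fun m => annpow m n v)) => [|m].
  by apply: (annpow_eq0 lv); lia.
by apply: (annpow_eq0 lv); lia.
Qed.

(** In generating functions, B(z) a_(-k-1) = (a_(-k-1) - z^(k+1) - z^(-k-1)) B(z). *)
Lemma bmode_cr n k v : bmode n (cr k v) =
  cr k (bmode n v) - (bmode (n - k.+1%:Z) v + bmode (n + k.+1%:Z) v).
Proof.
pose g m := annpow m (n - k.+1%:Z) v + annpow m (n + k.+1%:Z) v.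
have fg : finsupp g by apply: finsuppD; exact: finsupp_annpow.
have fg' : finsupp (fun m => m%:R *: g m.-1).
  have /finsupp_natP[R gR] := fg; apply: (@finsupp_nat _ R.+1) => -[|m] // mR.
  by rewrite gR ?scaler0.
transitivity (exp_sum (fun m => - 1 *: (m%:R *: g m.-1) + cr k (annpow m n v))).
  congr exp_sum; apply/funext => m; rewrite scaleN1r -scaleNr addrC.
  exact: annpow_cr.
rewrite exp_sumP //; last exact: (finsupp_raddf (cr k) (finsupp_annpow _ _)).
rewrite exp_sum_deriv // addrC scaleN1r; congr (_ - _).
  by apply: (esym (linear_exp_sum (cr k) _)); exact: finsupp_annpow.
by rewrite exp_sumD; try exact: finsupp_annpow.
Qed.

(** Induction over creation monomials: on both sides [bmode_cr] moves [cr k] out, and the shifts of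
    m and of n are independent. *)
Lemma bmode_comm (m n : int) v : bmode m (bmode n v) = bmode n (bmode m v).
Proof.
elim/fock_creation_ind: v m n => [|c u v IHu IHv|k v IHv] m n.
- by rewrite !bmode_vac !linearZ_LR /= !bmode_vac !scalerA mulrC.
- by rewrite !bmode_linear IHu IHv.
rewrite !bmode_cr !linearB !linearD /= !bmode_cr (IHv m n).
rewrite (IHv (m - _)) (IHv (m + _)) (IHv m (n - _)) (IHv m (n + _)).
by rewrite -!opprD addrAC.
Qed.
End Annihilation.

(** * Modes of the creation exponential *)

Section NewtonRecursion.
Variables (K : fieldType) (charK : [pchar K] =i pred0) (V : lmodType K).
Implicit Types (D : nat -> V -> V) (f g : int -> V).

(* f(w) = \sum_n (f n) w^n solves w f'(w) = (\sum_i D_i w^(i+1)) f(w). *)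
Definition newton_rec D f :=
  (forall n : int, n < 0 -> f n = 0) /\
  (forall (N : nat) (n : int), n <= N%:Z ->
     n%:~R *: f n = \sum_(i < N) D i (f (n - i.+1%:Z))).

(** In characteristic 0 the recursion can be divided by n > 0, so the value at 0 determines all
    others. *)
Lemma newton_rec_uniq D f g :
  newton_rec D f -> newton_rec D g -> f 0 = g 0 -> f =1 g.
Proof.
move=> [f_neg fD] [g_neg gD] fg0 [n|n]; last by rewrite f_neg ?g_neg.
elim/ltn_ind: n => -[//|n] IHn.
apply: (@scalerI _ _ (n.+1%:R)); first exact: natrS_neq0.
rewrite [LHS](fD n.+1 n.+1) // [RHS](gD n.+1 n.+1) //.
apply: eq_bigr => i _.
have -> : n.+1%:Z - i.+1%:Z = (n - i)%N%:Z by have := ltn_ord i; lia.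
by rewrite IHn //; lia.
Qed.

(* Passes from f(w) to (1 - c w) f(w):
   w d/dw log (1 - c w) = - \sum_i (c w)^(i+1). *)
Lemma newton_rec_shift D f (c : {linear V -> V}) :
  (forall i u v, D i (u - v) = D i u - D i v) ->
  (forall i u, D i (c u) = c (D i u)) ->
  newton_rec D f ->
  newton_rec (fun i u => D i u - iter i.+1 c u) (fun n => f n - c (f (n - 1))).
Proof.
move=> DB Dc [f_neg fD]; split=> [n n0|N n nN].
  by rewrite !f_neg //; [rewrite linear0 subr0|lia].
rewrite sumrB.
(* The sum telescopes; its last term involves [f] at n - N - 1 < 0 and vanishes. *)
have -> : \sum_(i < N) iter i.+1 c (f (n - i.+1%:Z) - c (f (n - i.+1%:Z - 1))) =
          c (f (n - 1)).
  pose t i := - iter i.+1 c (f (n - i.+1%:Z)).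
  have iterB j u v : iter j c (u - v) = iter j c u - iter j c v.
    by elim: j => //= j ->; rewrite linearB.
  transitivity (\sum_(0 <= i < N) (t i.+1 - t i)).
    rewrite big_mkord; apply: eq_bigr => i _; rewrite iterB addrC /t opprK -iterSr.
    by congr (- iter _ _ (f _) + _); lia.
  rewrite telescope_sumr // /t opprK f_neg ?addrA; last by lia.
  have iter0 j : iter j c 0 = 0 by elim: j => //= j ->; rewrite linear0.
  by rewrite iter0 oppr0 add0r.
rewrite scalerBr (fD N) // -linearZ_LR.
(* The part n - 1 is expanded by the recursion at n - 1; the remaining [f (n - 1)] gives the
   telescoped term. *)
have -> : n%:~R *: f (n - 1) = (n - 1)%:~R *: f (n - 1) + f (n - 1).
  by rewrite intrB scalerBl scale1r subrK.
rewrite (fD N) ?linearD ?opprD ?addrA; last by lia.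
rewrite linear_sum -sumrB; congr (_ - _); apply: eq_bigr => i _.
by rewrite DB Dc; congr (_ - c (D i (f _))); lia.
Qed.

End NewtonRecursion.

Section Creation.
Variables (K : fieldType) (charK : [pchar K] =i pred0) (M : fockSpace K).
Implicit Types (v w : M) (k m : nat) (n : int).

Notation cr k := (osc M (- k.+1%:Z)).

Definition crepow m : int -> M -> M :=
  iter m (fd_mul (@creation_series K M)) (@fd_one K M).

Lemma crepowE m n v : crepow m.+1 n v =
  \sum_(i \in [set: int]) creation_series i (crepow m (n - i) v).
Proof. by []. Qed.

Lemma creation_series_linear (i : int) : linear (@creation_series K M i).
Proof.
move=> a u v; rewrite /creation_series; case: ifP => _.
  by rewrite linearP scalerDr !scalerA mulrC.
by rewrite scaler0 addr0.
Qed.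

Lemma creation_series0 (i : int) : creation_series i (0 : M) = 0.
Proof. exact: (linear0 (lin_of (creation_series_linear i))). Qed.

(** The exponent of H(w) starts at w, so its m-th power starts at w^m. *)
Lemma crepow_eq0 m n v : n < m%:Z -> crepow m n v = 0.
Proof.
elim: m n => [|m IHm] n nm; first by rewrite /crepow /= /fd_one ifF //; lia.
rewrite crepowE fsbig1 // => i _; have [i0|i0] := ltrP 0 i.
  by rewrite IHm ?creation_series0 //; lia.
by rewrite /creation_series ltNge i0.
Qed.

Lemma crepowS m (N : nat) n v : n <= N%:Z -> crepow m.+1 n v =
  \sum_(i < N) (i.+1%:R)^-1 *: cr i (crepow m (n - i.+1%:Z) v).
Proof.
move=> nN; rewrite crepowE (@fsumE _ _ [seq i.+1%:Z | i <- iota 0 N]).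
- pose F (i : nat) := (i.+1%:R)^-1 *: cr i (crepow m (n - i.+1%:Z) v).
  rewrite big_map -(big_mkord xpredT F) /index_iota subn0.
  by apply: eq_bigr => i _.
- by rewrite map_inj_uniq ?iota_uniq // => i j [].
move=> i iN; have [i0|i0] := ltrP 0 i; last by rewrite /creation_series ltNge i0.
rewrite crepow_eq0 ?creation_series0 // ; have [|Ni] := ltrP N%:Z i; first by lia.
case/negP: iN; apply/mapP; exists (absz i).-1; last by lia.
by rewrite mem_iota; lia.
Qed.

Lemma crepow_linear m n : linear (crepow m n).
Proof.
move=> a u v; elim: m n => [|m IHm] n.
  by rewrite /crepow /= /fd_one; case: eqP; rewrite ?scaler0 ?addr0.
have nn : n <= (absz n)%:Z by lia.
rewrite !(crepowS _ _ nn) scaler_sumr -big_split; apply: eq_bigr => i _ /=.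
by rewrite IHm linearP scalerDr !scalerA mulrC.
Qed.

(** For the exponent E(w) of H(w), this is w d/dw E^m = m (w E') E^(m-1), where w E' has
    coefficients [cr i]. *)
Lemma crepow_deriv m (N : nat) n v : n <= N%:Z -> n%:~R *: crepow m n v =
  m%:R *: \sum_(i < N) cr i (crepow m.-1 (n - i.+1%:Z) v).
Proof.
elim: m n => [|m IHm] n nN.
  by rewrite /crepow /= /fd_one scale0r; case: eqP => [->|]; rewrite ?scale0r ?scaler0.
rewrite (crepowS _ _ nN) scaler_sumr.
(* Splits n as (i + 1) + (n - i - 1): the derivative falls on the first factor or on the other m. *)
transitivity (\sum_(i < N) (cr i (crepow m (n - i.+1%:Z) v) +
   (i.+1%:R)^-1 *: cr i ((n - i.+1%:Z)%:~R *: crepow m (n - i.+1%:Z) v))).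
  apply: eq_bigr => i _.
  rewrite linearZ_LR; set u := cr i _; rewrite !scalerA -[X in _ = X + _]scale1r.
  rewrite -scalerDl; congr (_ *: _); rewrite intrB mulrBr mulVf ?(natrS_neq0 charK) //.
  by rewrite addrC subrK mulrC.
rewrite big_split /= -[m.+1]add1n natrD scalerDl scale1r; congr (_ + _).
transitivity (\sum_(i < N) \sum_(j < N) m%:R *: ((i.+1%:R)^-1 *:
    cr i (cr j (crepow m.-1 (n - i.+1%:Z - j.+1%:Z) v)))).
  apply: eq_bigr => i _; rewrite IHm; last by lia.
  rewrite (linearZ_LR (cr i)) linear_sum scalerA mulrC -scalerA !scaler_sumr.
  by apply: eq_bigr => j _.
case: m {IHm} => [|m].
  by rewrite scale0r big1 // => i _; rewrite big1 // => j _; rewrite scale0r.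
(* Since creation operators commute, the differentiated factor can be moved to the front. *)
rewrite exchange_big scaler_sumr /=; apply: eq_bigr => j _.
rewrite -scaler_sumr; congr (_ *: _).
rewrite -[fd_mul _ _ _ _]/(crepow m.+1 (n - j.+1%:Z) v) (@crepowS _ N); last by lia.
rewrite linear_sum; apply: eq_bigr => i _ /=.
rewrite (linearZ_LR (cr j)) cr_cr; congr (_ *: cr j (cr i (crepow m _ v))).
by rewrite addrAC.
Qed.

Definition hmode n : M -> M := fd_exp (@creation_series K M) n.

Lemma finsupp_crepow n v : finsupp (fun m => crepow m n v).
Proof. by apply: (@finsupp_nat _ (absz n).+1) => m nm; apply: crepow_eq0; lia. Qed.

Lemma hmode_linear n : linear (hmode n).
Proof.
move=> a u v; rewrite -[RHS]exp_sumP; try exact: finsupp_crepow.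
by congr exp_sum; apply/funext => m; exact: crepow_linear.
Qed.

HB.instance Definition _ n :=
  GRing.isLinear.Build K M M *:%R (hmode n) (hmode_linear n).

Lemma hmode_neg n v : n < 0 -> hmode n v = 0.
Proof.
move=> n0; rewrite [LHS](@exp_sum0 K M (fun m => crepow m n v)) => [|m].
  by rewrite crepow_eq0.
by rewrite crepow_eq0 //; lia.
Qed.

Lemma hmode0 v : hmode 0 v = v.
Proof.
by rewrite [LHS](@exp_sum0 K M (fun m => crepow m 0 v)) => [//|m]; rewrite crepow_eq0.
Qed.

(** The differential equation w H' = (w E') H of H = exp(E). Relations for H(w) are proved below by
    comparing solutions of such recursions. *)
Lemma hmode_rec v : newton_rec (fun k => cr k) (fun n => hmode n v).
Proof.
split=> [n|N n nN]; first exact: hmode_neg.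
have fn (p : int) := finsupp_crepow p v.
rewrite [LHS](linear_exp_sum (n%:~R \*: idfun) (fn n)).
pose g m := \sum_(i < N) cr i (crepow m (n - i.+1%:Z) v).
transitivity (exp_sum (fun m => m%:R *: g m.-1)).
  by congr exp_sum; apply/funext => m; exact: crepow_deriv.
rewrite exp_sum_deriv //.
  rewrite exp_sum_ord => [|i]; last exact: (finsupp_raddf (cr i)).
  by apply: eq_bigr => i _; rewrite -(linear_exp_sum (cr i)).
apply: (@finsupp_nat _ N.+1) => m Nm; rewrite /g big1 // => i _.
by rewrite crepow_eq0 ?linear0 //; lia.
Qed.

End Creation.

Lemma newton_rec_morph (K : fieldType) (V W : lmodType K) (D : nat -> V -> V)
    (D' : nat -> W -> W) (G : {linear V -> W}) f :
  (forall i u, G (D i u) = D' i (G u)) ->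
  newton_rec D f -> newton_rec D' (fun n => G (f n)).
Proof.
move=> GD [f_neg fD]; split=> [n n0|N n nN]; first by rewrite f_neg ?linear0.
rewrite -linearZ_LR (fD N) // linear_sum; apply: eq_bigr => i _; exact: GD.
Qed.

Lemma iter_scale (K : fieldType) (V : lmodType K) (x : K) k (u : V) :
  iter k (x \*: idfun) u = x ^+ k *: u.
Proof. by elim: k => [|j /= ->]; rewrite ?expr0 ?scale1r // exprS scalerA. Qed.

(** * Commutation of the half vertex operators *)

Section Commutation.
Variables (K : fieldType) (charK : [pchar K] =i pred0) (M : fockSpace K).
Implicit Types (v w : M) (k : nat) (l m n : int) (x a : K).

Notation cr k := (osc M (- k.+1%:Z)).

(** The coefficient of w^n in (1 - x w) Gamma(x) H(w) = H(w) Gamma(x). Passing [Gamma x] adds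
    x^(k+1) to [cr k], and the factor 1 - x w removes it from the recursion. *)
Lemma Gamma_hmode x n v :
  Gamma x (hmode n v) - x *: Gamma x (hmode (n - 1) v) = hmode n (Gamma x v).
Proof.
pose D k u := cr k u + x ^+ k.+1 *: u : M.
have GD k u : Gamma x (cr k u) = D k (Gamma x u) by exact: Gamma_cr.
have := newton_rec_morph (G := lin_of (Gamma_linear x)) GD (hmode_rec charK v).
move=> /(newton_rec_shift (c := x \*: idfun)) /= Gr.
move: n; apply: (newton_rec_uniq charK _ (hmode_rec charK (Gamma x v))); last first.
  by rewrite hmode0 hmode_neg // (linear_fun0 (Gamma_linear x)) scaler0 subr0 hmode0.
have -> : (fun k => cr k : M -> M) = (fun k u => D k u - iter k.+1 (x \*: idfun) u).
  apply/funext => k; apply/funext => u; rewrite /D.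
  by rewrite iter_scale addrK.
apply: Gr => k u => [w|]; first by rewrite /D linearB scalerBr opprD addrACA.
by rewrite /D (linearZ_LR (cr k)) scalerDr !scalerA mulrC.
Qed.

(** Here x^(k+1) is subtracted with x = a, so the factor 1 - a w stands on the side of H(w). *)
Lemma Gamma_inv_hmode a n v : Gamma_inv a (hmode n v) =
  hmode n (Gamma_inv a v) - a *: hmode (n - 1) (Gamma_inv a v).
Proof.
pose D k u := cr k u - a ^+ k.+1 *: u : M.
have GD k u : Gamma_inv a (cr k u) = D k (Gamma_inv a u) by exact: Gamma_inv_cr.
have Gr := newton_rec_morph (G := lin_of (Gamma_inv_linear a)) GD (hmode_rec charK v).
move: n; apply: (newton_rec_uniq charK Gr); last first.
  by rewrite /= !hmode0 hmode_neg // scaler0 subr0.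
have -> : D = (fun k u => cr k u - iter k.+1 (a \*: idfun) u).
  by apply/funext => k; apply/funext => u; rewrite iter_scale.
apply: (newton_rec_shift (c := a \*: idfun)) (hmode_rec charK _) => k u => [w|].
  by rewrite linearB.
by rewrite (linearZ_LR (cr k)).
Qed.

(** The coefficient of z^m w^n in B(z) H(w) = (1 - z w)(1 - w / z) H(w) B(z). The recursion in w is
    run in the module of functions [int -> M], that is, of distributions in z. *)
Lemma bmode_hmode m n v : bmode m (hmode n v) =
  hmode n (bmode m v) - hmode (n - 1) (bmode (m - 1) v) -
  hmode (n - 1) (bmode (m + 1) v) + hmode (n - 2) (bmode m v).
Proof.
have bL : linear (fun u : M => (fun p => bmode p u : M)).
  by move=> c u w; apply/funext => j; exact: bmode_linear.
(* [sh j] is multiplication by z^(-j). *)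
pose sh (j : int) (u : int -> M) p := u (p + j).
have shL j : linear (sh j) by [].
have iter_sh j k u p : iter k (sh j) u p = u (p + j * k%:Z).
  elim: k p => [|k IHk] p /=; first by rewrite mulr0 addr0.
  by rewrite /sh IHk; congr u; lia.
pose D0 k (u : int -> M) p := cr k (u p).
pose D1 k (u : int -> M) p := cr k (u p) - u (p - k.+1%:Z).
pose D2 k (u : int -> M) p := cr k (u p) - u (p - k.+1%:Z) - u (p + k.+1%:Z).
pose f0 j p := hmode j (bmode p v).
have f0_rec : newton_rec D0 f0.
  split=> [j j0|N j jN]; first by apply/funext => p; rewrite /f0 hmode_neg.
  apply/funext => p; rewrite fct_sumE.
  exact: (hmode_rec charK (bmode p v)).2.
(* [f1] is [f0] times 1 - z w, and [f2] below is [f1] times 1 - w / z; each factor adds one shift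
   term to the recursion. *)
pose f1 j p := f0 j p - f0 (j - 1) (p - 1).
have f1_rec : newton_rec D1 f1.
  have -> : D1 = (fun k u => D0 k u - iter k.+1 (sh (- 1)) u).
    apply/funext => k; apply/funext => u; apply/funext => p.
    by rewrite -[RHS]/(cr k (u p) - iter k.+1 (sh (- 1)) u p) iter_sh mulN1r.
  apply: (newton_rec_shift (c := lin_of (shL (- 1))) _ _ f0_rec) => k u => [w|//].
  by apply/funext => p; exact: linearB.
pose f2 j p := f1 j p - f1 (j - 1) (p + 1).
have f2_rec : newton_rec D2 f2.
  have -> : D2 = (fun k u => D1 k u - iter k.+1 (sh 1) u).
    apply/funext => k; apply/funext => u; apply/funext => p.
    by rewrite -[RHS]/(D1 k u p - iter k.+1 (sh 1) u p) iter_sh mul1r.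
  apply: (newton_rec_shift (c := lin_of (shL 1)) _ _ f1_rec) => k u => [w|].
    apply/funext => p.
    rewrite -[LHS]/(cr k (u p - w p) - (u (p - k.+1%:Z) - w (p - k.+1%:Z))).
    rewrite -[RHS]/(D1 k u p - D1 k w p) /D1 linearB !opprB addrACA [RHS]addrACA.
    by congr (_ + _); exact: addrC.
  by apply/funext => p; rewrite /D1 /= /sh addrAC.
have GD k u : (fun p => bmode p (cr k u)) = D2 k (fun p => bmode p u).
  by apply/funext => p; rewrite /D2 bmode_cr // opprD addrA.
have Gr := newton_rec_morph (G := lin_of bL) GD (hmode_rec charK v).
have f20 : lin_of bL (hmode 0 v) = f2 0.
  apply/funext => p; rewrite /f2 /f1 /f0 !hmode0 !(@hmode_neg _ _ (0 - _)) //.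
  by rewrite hmode_neg // !subr0.
have /(congr1 (@^~ m)) := newton_rec_uniq charK Gr f2_rec f20 n.
rewrite /f2 /f1 /f0 /= => ->.
have -> : n - 2 = n - 1 - 1 by lia.
by rewrite opprB addrA addrAC addrK.
Qed.

End Commutation.

(** * Modes of the vertex operator *)

Section VertexModes.
Variables (K : fieldType) (charK : [pchar K] =i pred0) (M : fockSpace K).
Implicit Types (v w : M) (l m n : int).

Definition hb_mode : int -> M -> M := fd_mul (@hmode K M) (@bmode K M).

Lemma finsupp_hb l v : finsupp (fun m => hmode (l - m) (bmode m v)).
Proof.
have [R vR] := finsupp_bmode v; apply: (@finsupp_int _ R) => m Rm.
by rewrite vR ?linear0.
Qed.

Lemma hb_modeE l v : hb_mode l v = \sum_(m \in [set: int]) hmode (l - m) (bmode m v).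
Proof.
rewrite /hb_mode /fd_mul (reindex_fsbigT (fun m => l - m)) /=.
  by apply: eq_fsbigr => m _; rewrite subKr.
by exists (fun m => l - m) => m; rewrite subKr.
Qed.

Lemma hb_mode_linear l : linear (hb_mode l).
Proof.
move=> a u v; rewrite !hb_modeE -fsumP; try exact: finsupp_hb.
by apply: eq_fsbigr => m _; rewrite bmode_linear hmode_linear.
Qed.

(** The relation for H(w) extends to H(w) B(w) because the modes of B commute. *)
Lemma bmode_hb m l v : bmode m (hb_mode l v) =
  hb_mode l (bmode m v) - hb_mode (l - 1) (bmode (m - 1) v) -
  hb_mode (l - 1) (bmode (m + 1) v) + hb_mode (l - 2) (bmode m v).
Proof.
rewrite !hb_modeE (fsum_raddf (bmode m)); last exact: finsupp_hb.
have fhb n w := finsupp_hb n w.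
have f12 := finsuppB (fhb l (bmode m v)) (fhb (l - 1) (bmode (m - 1) v)).
have f123 := finsuppB f12 (fhb (l - 1) (bmode (m + 1) v)).
rewrite -fsumB // -fsumB // -fsumD //; apply: eq_fsbigr => j _ /=.
rewrite bmode_hmode // ![bmode j (bmode _ v)]bmode_comm //.
by rewrite ![l - _ - j]addrAC.
Qed.

Lemma vertexUE l v : vertexU l v = hb_mode l v + hb_mode (l - 1) v.
Proof.
transitivity (\sum_(i \in [set: int]) one_plus_z i (hb_mode (l - i) v)) => //.
rewrite (@fsumE _ _ [:: 0; 1]) // => [|i].
  by rewrite !big_cons big_nil /one_plus_z /= subr0 addr0.
by rewrite !inE negb_or /one_plus_z => /andP[/negPf-> /negPf->].
Qed.

Lemma vertexU_linear l : linear (@vertexU K M l).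
Proof. by move=> a u v; rewrite !vertexUE !hb_mode_linear scalerDr addrACA. Qed.

HB.instance Definition _ l :=
  GRing.isLinear.Build K M M *:%R (@vertexU K M l) (vertexU_linear l).

Lemma bmode_vertexU m l v : bmode m (vertexU l v) =
  vertexU l (bmode m v) - vertexU (l - 1) (bmode (m - 1) v) -
  vertexU (l - 1) (bmode (m + 1) v) + vertexU (l - 2) (bmode m v).
Proof.
rewrite !vertexUE linearD /= !bmode_hb !opprD.
rewrite [l - 1 - 2]addrAC addrACA; congr (_ + _).
by rewrite addrACA; congr (_ + _); rewrite addrACA.
Qed.

End VertexModes.

(** * Products of a polynomial and a formal distribution *)

Section PolyConvolution.
Variables (K : fieldType) (V : lmodType K).
Implicit Types (q : {poly K}) (f : int -> V) (n : int).

(** The coefficient of z^n in q(z) f(z). *)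
Definition conv q f n : V := \sum_(i < size q) q`_i *: f (n - i%:Z).

Lemma convE N q f n : (size q <= N)%N ->
  conv q f n = \sum_(i < N) q`_i *: f (n - i%:Z).
Proof.
move=> qN; rewrite /conv (big_ord_widen _ (fun i => q`_i *: f (n - i%:Z)) qN).
rewrite big_mkcond; apply: eq_bigr => i _; case: ltnP => // qi.
by rewrite nth_default ?scale0r.
Qed.

Lemma convMX q (x : K) f n :
  conv (q * (1 - x *: 'X)) f n = conv q f n - x *: conv q f (n - 1).
Proof.
have coefM i : (q * (1 - x *: 'X))`_i = q`_i - x * (if i is j.+1 then q`_j else 0).
  rewrite mulrBr mulr1 -scalerAr coefB coefZ coefMX.
  by case: i.
have sz : (size (q * (1 - x *: 'X))%R <= (size q).+1)%N.
  apply/leq_sizeP => -[//|i] qi; rewrite coefM !nth_default ?mulr0 ?subr0 //.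
  exact: leqW.
rewrite (convE _ _ sz) (convE f n (leqnSn _)) /conv scaler_sumr.
transitivity (\sum_(i < (size q).+1) q`_i *: f (n - i%:Z) -
  \sum_(i < (size q).+1) (x * (if (i : nat) is j.+1 then q`_j else 0)) *: f (n - i%:Z)).
  by rewrite -sumrB; apply: eq_bigr => i _; rewrite coefM scalerBl.
congr (_ - _); rewrite big_ord_recl mulr0 scale0r add0r.
apply: eq_bigr => i _; rewrite scalerA; congr (_ *: f _).
by rewrite /= /bump /= add1n -addn1 PoszD opprD addrA addrAC.
Qed.

Lemma conv_shift q (x : K) f n :
  conv q (fun m => f m - x *: f (m - 1)) n = conv q f n - x *: conv q f (n - 1).
Proof.
rewrite /conv scaler_sumr -sumrB; apply: eq_bigr => i _.
by rewrite scalerBr !scalerA mulrC [n - 1 - _]addrAC.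
Qed.

Lemma conv_trunc q f (n : nat) : (forall m, m < 0 -> f m = 0) ->
  conv q f n%:Z = \sum_(i < n.+1) q`_i *: f (n%:Z - i%:Z).
Proof.
move=> f_neg; rewrite (@convE (n.+1 + size q)) ?leq_addl //.
rewrite (big_ord_widen _ (fun i => q`_i *: f (n%:Z - i%:Z)) (leq_addr (size q) n.+1)).
rewrite [RHS]big_mkcond; apply: eq_bigr => i _; case: ltnP => // ni.
by rewrite f_neg ?scaler0 //; lia.
Qed.

Lemma conv1 f n : conv 1 f n = f n.
Proof. by rewrite /conv size_poly1 big_ord1 coef1 scale1r subr0. Qed.

End PolyConvolution.

Lemma conv_linear (K : fieldType) (V W : lmodType K) (G : {linear V -> W}) q
    (f : int -> V) n : G (conv q f n) = conv q (G \o f) n.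
Proof.
by rewrite /conv linear_sum; apply: eq_bigr => i _; rewrite linearZ_LR.
Qed.

(** * The functional defining sBD *)

Section CharacterFunctional.
Variables (K : fieldType) (charK : [pchar K] =i pred0) (M : fockSpace K).
Variables (N : nat) (x : 'I_N -> K) (alpha : K).
Implicit Types (v w : M) (n : int).

Definition so_functional v : K := dvac M (Gamma_pm x (Gamma_inv alpha v)).

Lemma Gamma_seq_linear (s : seq 'I_N) : linear (fun v : M =>
  foldr (fun i w => Gamma (x i) (Gamma (x i)^-1 w)) v s).
Proof. by elim: s => //= i s IHs a u v; rewrite IHs !Gamma_linear. Qed.

Lemma so_functional_linear : scalar so_functional.
Proof.
by move=> a u v; rewrite /so_functional /Gamma_pm Gamma_inv_linear Gamma_seq_linear linearP.
Qed.

HB.instance Definition _ := GRing.isLinear.Build K M K *%R so_functional so_functional_linear.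

Lemma so_functional_vac : so_functional (vac M) = 1.
Proof.
rewrite /so_functional Gamma_inv_vac /Gamma_pm -[RHS](dvac_vac M); congr (dvac M _).
by elim: (enum 'I_N) => //= i s ->; rewrite !Gamma_vac.
Qed.

(** For n > 0 the recursion writes n H_n v as a sum of vectors [cr i u], all killed by [dvac]. *)
Lemma dvac_hmode n v : dvac M (hmode n v) = (n == 0)%:R * dvac M v.
Proof.
case: n => [[|n]|n]; first by rewrite hmode0 mul1r.
  rewrite mul0r; apply: (mulfI (natrS_neq0 charK n)); rewrite mulr0.
  have := (hmode_rec charK v).2 n.+1 n.+1%:Z (lexx _).
  move/(congr1 (dvac M)); rewrite linearZ_LR [RHS]linear_sum.
  by rewrite [RHS]big1 => [E|i _]; [exact: E|exact: dvac_osc].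
by rewrite hmode_neg // linear0 mul0r.
Qed.

(** By [Gamma_hmode], each [Gamma y] moved past H(w) costs a factor 1 - y w; the polynomial collects
    these factors. *)
Lemma Gamma_seq_hmode (s : seq 'I_N) n v :
  conv (\prod_(i <- s) ((1 - x i *: 'X) * (1 - (x i)^-1 *: 'X)))
    (fun m => foldr (fun i w => Gamma (x i) (Gamma (x i)^-1 w)) (hmode m v) s) n =
  hmode n (foldr (fun i w => Gamma (x i) (Gamma (x i)^-1 w)) v s).
Proof.
elim: s n => [|i s IHs] n /=; first by rewrite big_nil conv1.
set w := foldr _ v s in IHs *.
rewrite big_cons mulrC mulrA [_ * (1 - _) * _]mulrAC.
set q := \prod_(j <- s) _ in IHs *.
pose G := lin_of (Gamma_linear (M := M) (x i)).
pose G' := lin_of (Gamma_linear (M := M) (x i)^-1).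
pose h m := foldr (fun i w => Gamma (x i) (Gamma (x i)^-1 w)) (hmode m v) s.
have fE m : conv q (fun m => Gamma (x i) (Gamma (x i)^-1 (h m))) m =
            Gamma (x i) (Gamma (x i)^-1 (hmode m w)).
  by rewrite -[LHS](conv_linear G q (G' \o h)) -(conv_linear G' q h) IHs.
rewrite !convMX !fE.
have GE m : Gamma (x i) (Gamma (x i)^-1 (hmode m w)) -
    (x i)^-1 *: Gamma (x i) (Gamma (x i)^-1 (hmode (m - 1) w)) =
    Gamma (x i) (hmode m (Gamma (x i)^-1 w)).
  by rewrite -(Gamma_hmode charK) -[RHS]/(G _) (linearB G) (linearZ_LR G).
by rewrite (GE n) (GE (n - 1)) (Gamma_hmode charK).
Qed.

(** Moving [Gamma_inv alpha] past H(z) gives 1 - alpha z, the other half vertex operators are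
    absorbed by the denominator, and the dual vacuum fixes H(z). [K^o] makes the scalars a module
    for [conv]. *)
Lemma so_functional_conv n v :
  conv (hbar_denom x) (fun m => so_functional (hmode m v) : K^o) n =
  ((n == 0)%:R - alpha * (n == 1)%:R) * so_functional v.
Proof.
pose w := Gamma_inv alpha v; pose G := lin_of (Gamma_seq_linear (enum 'I_N)).
have GE m : so_functional (hmode m v) =
    dvac M (G (hmode m w)) - alpha * dvac M (G (hmode (m - 1) w)).
  rewrite /so_functional Gamma_inv_hmode // -[Gamma_pm _ _]/(G _).
  by rewrite !linearB !linearZ_LR.
pose f m : K^o := dvac M (G (hmode m w)).
transitivity (conv (hbar_denom x) (fun m => f m - alpha *: f (m - 1)) n).
  by congr conv; apply/funext => m; rewrite GE.
rewrite conv_shift.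
have dE m : conv (hbar_denom x) f m = dvac M (hmode m (G w)).
  pose d : {linear M -> K^o} := dvac M.
  rewrite -[LHS](conv_linear d _ (fun m => G (hmode m w))) /hbar_denom -big_enum /=.
  by rewrite /d /= Gamma_seq_hmode.
rewrite !dE !dvac_hmode subr_eq0 mulrBl; congr (_ - _).
by rewrite -[LHS]/(_ * _) mulrA.
Qed.

Lemma hbar_denom_coef0 : (hbar_denom x)`_0 = 1.
Proof.
rewrite -horner_coef0 horner_prod big1 // => i _.
by rewrite !hornerE !subr0 mulr1.
Qed.

(** Both sides have the same product with [hbar_denom x], whose constant term is 1, so they agree by
    induction on n. *)
Lemma so_functional_hmode (hbar : int -> K) n v : is_hbar x alpha hbar ->
  so_functional (hmode n v) = hbar n * so_functional v.
Proof.
move=> [hbar_neg hbarE]; case: n => n; last first.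
  by rewrite hmode_neg // hbar_neg // linear0 mul0r.
elim/ltn_ind: n => n IHn.
have := so_functional_conv n%:Z v; rewrite conv_trunc => [|m m0]; last first.
  by rewrite hmode_neg // linear0.
have -> : (n%:Z == 0)%:R - alpha * (n%:Z == 1)%:R = (1 - alpha *: 'X)`_n.
  by rewrite coefB coef1 coefZ coefX !eqz_nat.
rewrite -hbarE mulr_suml !big_ord_recl hbar_denom_coef0 scale1r mul1r subr0.
set r1 := \sum_(i < n) _; set r2 := \sum_(i < n) _; suff -> : r1 = r2 by move/addIr.
apply: eq_bigr => i _; rewrite -mulrA -[LHS]/(_ * _); congr (_ * _).
have -> : n%:Z - (bump 0 i)%:Z = (n - i.+1)%N%:Z.
  by rewrite /bump /=; have := ltn_ord i; lia.
by apply: IHn; have := ltn_ord i; lia.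
Qed.

End CharacterFunctional.

(** * Determinantal expansion *)

Section Pairing.
Variable K : fieldType.
Implicit Types (g : int -> K) (p q : {poly K}).

(** The adjoint of multiplication by z + 1/z for the pairing below. *)
Definition nbr_sum g (m : int) : K := g (m - 1) + g (m + 1).

(* The pairing \sum_m (g m) (c m) with the coefficients of the symmetric
   Laurent polynomial p(z + 1/z) = \sum_m (c m) z^m. *)
Definition laurent_pair g p : K := \sum_(k < size p) p`_k * iter k nbr_sum g 0.

Lemma laurent_pairE N g p : (size p <= N)%N ->
  laurent_pair g p = \sum_(k < N) p`_k * iter k nbr_sum g 0.
Proof.
move=> pN; rewrite /laurent_pair (big_ord_widen _ (fun k => p`_k * iter k nbr_sum g 0) pN).
rewrite big_mkcond; apply: eq_bigr => k _; case: ltnP => // pk.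
by rewrite nth_default ?mul0r.
Qed.

Lemma laurent_pair_linear g : scalar (laurent_pair g).
Proof.
move=> c p q; pose N := maxn (size p) (size q).
have pN : (size p <= N)%N by exact: leq_maxl.
have qN : (size q <= N)%N by exact: leq_maxr.
have pqN : (size (c *: p + q)%R <= N)%N.
  apply/leq_sizeP => j Nj; rewrite coefD coefZ !nth_default ?mulr0 ?addr0 //.
    exact: leq_trans Nj.
  exact: leq_trans Nj.
rewrite !(@laurent_pairE N) // mulr_sumr -big_split.
by apply: eq_bigr => k _ /=; rewrite coefD coefZ mulrDl mulrA.
Qed.

HB.instance Definition _ g :=
  GRing.isLinear.Build K {poly K} K *%R (laurent_pair g) (laurent_pair_linear g).

Lemma laurent_pairC g c : laurent_pair g c%:P = c * g 0.
Proof. by rewrite (@laurent_pairE 1) ?size_polyC_leq1 // big_ord1 coefC. Qed.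

Lemma laurent_pairX g p : laurent_pair g ('X * p) = laurent_pair (nbr_sum g) p.
Proof.
have Xp : (size ('X * p)%R <= (size p).+1)%N.
  by apply/leq_sizeP => -[//|j] pj; rewrite coefXM /= nth_default.
rewrite (laurent_pairE _ Xp) big_ord_recl coefXM mul0r add0r.
by apply: eq_bigr => k _; rewrite coefXM /= -iterSr.
Qed.

Lemma laurent_pairD g1 g2 p : laurent_pair (fun m => g1 m + g2 m) p =
  laurent_pair g1 p + laurent_pair g2 p.
Proof.
rewrite /laurent_pair -big_split; apply: eq_bigr => k _ /=; rewrite -mulrDr.
congr (_ * _); move: 0; elim: (k : nat) => //= k' IHk m.
by rewrite /nbr_sum !IHk addrACA.
Qed.

End Pairing.

(** * The shift operator acting on products and determinants *)

Section Theta.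
Variable K : fieldType.
Implicit Types (F : seq int -> {poly K}) (ls : seq int).

(* Applies \prod_j (1 - (z + 1/z) S_j + S_j^2) with 'X for z + 1/z, where S_j
   decreases the j-th argument of F. *)
Fixpoint theta F ls : {poly K} :=
  if ls is l :: ls' then
    theta (fun s => F (l :: s)) ls' - 'X * theta (fun s => F (l - 1 :: s)) ls' +
    theta (fun s => F (l - 2 :: s)) ls'
  else F [::].

Lemma eq_theta F G ls :
  (forall s, size s = size ls -> F s = G s) -> theta F ls = theta G ls.
Proof.
elim: ls F G => [|l ls IHls] F G FG /=; first exact: FG.
by congr (_ - _ * _ + _); apply: IHls => s sls; rewrite FG //= sls.
Qed.

Lemma thetaZ (c : {poly K}) F ls : theta (fun s => c * F s) ls = c * theta F ls.
Proof.
elim: ls F => //= l ls IHls F; rewrite !IHls mulrDr mulrBr.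
by rewrite mulrCA.
Qed.

Lemma theta_sum (I : finType) (F : I -> seq int -> {poly K}) ls :
  theta (fun s => \sum_i F i s) ls = \sum_i theta (F i) ls.
Proof.
elim: ls F => //= l ls IHls F; rewrite !IHls big_split /= sumrB.
by rewrite mulr_sumr.
Qed.

Definition theta1 (g : int -> {poly K}) l := g l - 'X * g (l - 1) + g (l - 2).

Lemma theta_prod n (g : 'I_n -> int -> {poly K}) ls : size ls = n ->
  theta (fun s => \prod_i g i (nth 0 s i)) ls = \prod_i theta1 (g i) (nth 0 ls i).
Proof.
elim: ls n g => [|l ls IHls] [|n] g //= => [_|[lsn]]; first by rewrite !big_ord0.
rewrite big_ord_recl /= -(IHls n (fun i => g (lift ord0 i))) //.
have E t : theta (fun s => \prod_(i < n.+1) g i (nth 0 (t :: s) i)) ls =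
    g ord0 t * theta (fun s => \prod_i g (lift ord0 i) (nth 0 s i)) ls.
  by rewrite -thetaZ; apply: eq_theta => s _; rewrite big_ord_recl.
by rewrite !E /theta1 !mulrDl mulNr mulrA.
Qed.

(** Each term of the Leibniz expansion has one entry per row, and only row i depends on the i-th
    argument; so [theta] acts row by row. *)
Lemma theta_det n (g : 'I_n -> 'I_n -> int -> {poly K}) ls : size ls = n ->
  theta (fun s => \det (\matrix_(i, j) g i j (nth 0 s i))) ls =
  \det (\matrix_(i, j) theta1 (g i j) (nth 0 ls i)).
Proof.
move=> lsn; rewrite /determinant theta_sum; apply: eq_bigr => s _.
rewrite thetaZ; congr (_ * _).
transitivity (theta (fun t => \prod_i g i (s i) (nth 0 t i)) ls).
  by apply: eq_theta => t _; apply: eq_bigr => i _; rewrite mxE.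
rewrite (theta_prod (fun i => g i (s i))) //.
by apply: eq_bigr => i _; rewrite mxE.
Qed.

End Theta.

(** * Determinant entries and column operations *)

Section Determinants.
Variables (K : fieldType) (hbar : int -> K).
Implicit Types (l : int) (n j : nat).

(** The entry in column j, counted from 0, with l = lambda_i - i for the row i, also counted from
    0. *)
Definition hcol j l : K := hbar (l + j%:Z) + hbar (l - j%:Z - 1).

(* The reflection symmetry [hcol (-1) = hcol 0] makes the truncated
   predecessor [j.-1] correct at [j = 0], here and in [fold_polyS]. *)
Lemma hcol_rec j l :
  hcol j (l + 1) + hcol j (l - 1) = hcol j.+1 l + hcol j.-1 l.
Proof.
transitivity (hbar (l + j%:Z + 1) + hbar (l - j%:Z) +
              (hbar (l + j%:Z - 1) + hbar (l - j%:Z - 2))).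
  by congr ((hbar _ + hbar _) + (hbar _ + hbar _)); lia.
transitivity (hbar (l + j%:Z + 1) + hbar (l - j%:Z - 2) +
              (hbar (l + j%:Z - 1) + hbar (l - j%:Z))); first by ring.
congr (_ + _); first by congr (hbar _ + hbar _); lia.
case: j => [|j]; last by congr (hbar _ + hbar _); lia.
by rewrite addrC; congr (hbar _ + hbar _); lia.
Qed.

(** At 'X = z + 1/z this is (z^(j+1) + z^(-j)) / (1 + z), a Laurent polynomial. *)
Fixpoint fold_poly j : {poly K} :=
  match j with
  | 0 => 1
  | 1 => 'X - 1
  | (j.+1 as k).+1 => 'X * fold_poly k - fold_poly j
  end.

Lemma fold_polyS j : fold_poly j.+1 = 'X * fold_poly j - fold_poly j.-1.
Proof. by case: j => //=; rewrite mulr1. Qed.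

(** [hcol 0] carries the factor 1 + z, which cancels the denominator of [fold_poly j] and leaves the
    shifts by j + 1 and -j. *)
Lemma fold_poly_hcol j l :
  laurent_pair (fun m => hcol 0 (l - m)) (fold_poly j) = hcol j l.
Proof.
elim/ltn_ind: j l => -[|j] IHj l; first by rewrite /= -polyC1 laurent_pairC mul1r subr0.
rewrite fold_polyS linearB /= laurent_pairX.
have -> : nbr_sum (fun m => hcol 0 (l - m)) =
    (fun m => hcol 0 (l + 1 - m) + hcol 0 (l - 1 - m)).
  apply/funext => m; rewrite /nbr_sum; congr (hcol 0 _ + hcol 0 _); lia.
rewrite laurent_pairD !IHj ?leq_pred //; last by case: j {IHj} => // j; lia.
by rewrite hcol_rec addrK.
Qed.

(* Column operations: column j+1 is replaced by
   (column j+1) - 'X (column j) + (column j-1), which kills the first row. *)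
Lemma det_fold_poly n (c : 'I_n -> nat -> {poly K}) :
  \det (\matrix_(i < n.+1, j < n.+1)
     (if unlift ord0 i is Some i' then c i' j else fold_poly j)) =
  \det (\matrix_(i < n, j < n) (c i j.+1 - 'X * c i j + c i j.-1)).
Proof.
set B := \matrix_(i, j) _.
(* The matrix of the column operations: upper unitriangular, with column 0 left unchanged. *)
pose T : 'M[{poly K}]_n.+1 := \matrix_(j, k)
  (if (k : nat) is k'.+1 then
     ((j : nat) == k'.+1)%:R - 'X * ((j : nat) == k')%:R + ((j : nat) == k'.-1)%:R
   else ((j : nat) == 0)%:R).
have detT : \det T = 1.
  rewrite -det_tr det_trig; last first.
    apply/is_trig_mxP => i j ij; rewrite !mxE; case: (i : nat) ij => [|k] ij.
      by rewrite gtn_eqF.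
    rewrite !gtn_eqF ?mulr0 ?subr0 ?addr0 //; lia.
  rewrite big1 // => i _; rewrite !mxE; case: (i : nat) => // k.
  by rewrite eqxx !gtn_eqF ?mulr0 ?subr0 ?addr0 //; lia.
have sum_delta (b : nat -> {poly K}) k : (k < n.+1)%N ->
    \sum_(j < n.+1) b j * ((j : nat) == k)%:R = b k.
  move=> kn; rewrite (bigD1 (Ordinal kn)) //= eqxx mulr1 big1 ?addr0 // => j jk.
  by rewrite (negPf (_ : (j : nat) != k)) ?mulr0.
pose b i j := if unlift ord0 i is Some i' then c i' j else fold_poly j.
have BT i (k : 'I_n.+1) : (B *m T) i k = if (k : nat) is k'.+1 then
    b i k'.+1 - 'X * b i k' + b i k'.-1 else b i 0.
  rewrite mxE; case: k => -[|k] kn /=.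
    rewrite -(sum_delta (b i) 0) //; apply: eq_bigr => j _; by rewrite !mxE.
  rewrite -(sum_delta (b i) k.+1) // -(sum_delta (b i) k); last exact: ltnW.
  rewrite -(sum_delta (b i) k.-1); last by lia.
  rewrite mulr_sumr -sumrB -big_split; apply: eq_bigr => j _ /=.
  by rewrite !mxE -/(b i j) mulrDr mulrBr mulrCA.
(* By the recursion of [fold_poly], the first row of B T is (1, 0, ..., 0), so a single cofactor
   remains. *)
rewrite -[LHS]mulr1 -detT -det_mulmx (expand_det_row _ ord0).
rewrite big_ord_recl big1 => [|j _]; last first.
  rewrite BT /= /b unlift_none; set F := (X in X * _ = _).
  suff -> : F = 0 by rewrite mul0r.
  by rewrite /F -[X in X - _]/(fold_poly j.+1) fold_polyS; ring.
rewrite BT /b unlift_none mul1r addr0 /cofactor expr0 mul1r; congr (\det _).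
by apply/matrixP => i j; rewrite 2!mxE BT [RHS]mxE /b liftK.
Qed.

End Determinants.

(** * The determinant formula *)

Section JacobiTrudi.
Variables (K : fieldType) (charK : [pchar K] =i pred0) (M : fockSpace K).
Variables (N : nat) (x : 'I_N -> K) (alpha : K) (hbar : int -> K).
Hypothesis hbarP : is_hbar x alpha hbar.
Implicit Types (l : int) (ls : seq int) (v : M).

(** Integer indices, as the shifts in [theta] can make them negative. *)
Definition so_vec ls : M := foldr (fun l v => vertexU l v) (vac M) ls.

(** B(z) passes the modes one by one, by [bmode_vertexU], down to the vacuum, where only m = 0
    survives. The induction changes both parameters: [E] absorbs the leading mode, and z + 1/z turns
    [g] into [nbr_sum g]. *)
Lemma pair_bmode (g : int -> K) (E : {scalar M}) ls :
  \sum_(m \in [set: int]) g m * E (bmode m (so_vec ls)) =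
  laurent_pair g (theta (fun s => (E (so_vec s))%:P) ls).
Proof.
elim: ls g E => [|l ls IHls] g E /=.
  rewrite laurent_pairC mulrC -[RHS](fsum_delta 0 (fun m => g m * E (vac M))).
  apply: eq_fsbigr => m _; rewrite bmode_vac linearZ_LR /=.
  by case: eqP; rewrite ?mul1r ?mul0r ?mulr0.
have [R wR] := finsupp_bmode (so_vec ls).
pose EU k : {scalar M} := E \o vertexU k.
have fe k : finsupp (fun m => EU k (bmode m (so_vec ls))).
  by apply: (@finsupp_int _ R) => m Rm; rewrite wR ?linear0.
have fge k j : finsupp (fun m : int => g m * EU k (bmode (m + j) (so_vec ls))).
  have [s es] := finsupp_shift j (fe k).
  by exists s => m /es /= ->; rewrite mulr0.
have [S SE] : {S : int -> int -> K | forall k j,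
    S k j = \sum_(m \in [set: int]) g m * EU k (bmode (m + j) (so_vec ls))}.
  by exists (fun k j => \sum_(m \in [set: int]) g m * EU k (bmode (m + j) (so_vec ls))).
have sumE : \sum_(m \in [set: int]) g m * E (bmode m (vertexU l (so_vec ls))) =
    S l 0 - S (l - 1) (- 1) - S (l - 1) 1 + S (l - 2) 0.
  rewrite !SE.
  have f12 := finsuppB (fge l 0) (fge (l - 1) (- 1)).
  have f123 := finsuppB f12 (fge (l - 1) 1).
  rewrite -(fsumB (fge l 0)) // -(fsumB f12) // -(fsumD f123) //.
  apply: eq_fsbigr => m _; rewrite bmode_vertexU // linearD !linearB /= addr0.
  by rewrite mulrDr !mulrBr.
have S0 k : S k 0 = laurent_pair g (theta (fun s => (E (so_vec (k :: s)))%:P) ls).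
  rewrite SE -[RHS](IHls g (EU k)); apply: eq_fsbigr => m _.
  by rewrite addr0.
(* Reindexing moves the shifts by -1 and 1 onto [g], where they add up to [nbr_sum g]. *)
have S1 k : S k (- 1) + S k 1 =
    laurent_pair (nbr_sum g) (theta (fun s => (E (so_vec (k :: s)))%:P) ls).
  rewrite -[RHS](IHls (nbr_sum g) (EU k)).
  have shift j : S k j = \sum_(m \in [set: int]) g (m - j) * EU k (bmode m (so_vec ls)).
    rewrite SE (reindex_fsbigT (fun m => m - j)) /=; last first.
      by exists (fun m => m + j) => m; rewrite ?subrK ?addrK.
    by apply: eq_fsbigr => m _; rewrite subrK.
  have fs j : finsupp (fun m : int => g (m - j) * EU k (bmode m (so_vec ls))).
    by have [s es] := fe k; exists s => m /es ->; rewrite mulr0.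
  rewrite (shift (- 1)) (shift 1) -(fsumD (fs (- 1))) //.
  by apply: eq_fsbigr => m _; rewrite opprK -mulrDl /nbr_sum [g _ + _]addrC.
rewrite sumE linearD linearB /= laurent_pairX -(S1 (l - 1)) -(S0 l) -(S0 (l - 2)).
by congr (_ + _); rewrite -[LHS]addrA -[X in _ + X = _]opprD.
Qed.

(** The functional turns H into [hbar], and the factor 1 + z of U(z) turns [hbar] into
    [hcol hbar 0]. *)
Lemma so_functional_vertexU l v : so_functional x alpha (vertexU l v) =
  \sum_(m \in [set: int]) hcol hbar 0 (l - m) * so_functional x alpha (bmode m v).
Proof.
have hbE n : so_functional x alpha (hb_mode n v) =
    \sum_(m \in [set: int]) hbar (n - m) * so_functional x alpha (bmode m v).
  rewrite hb_modeE (fsum_raddf (so_functional x alpha)); last exact: finsupp_hb.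
  by apply: eq_fsbigr => m _; exact: so_functional_hmode.
have [R vR] := finsupp_bmode v.
have fb n : finsupp (fun m => hbar (n - m) * so_functional x alpha (bmode m v)).
  by apply: (@finsupp_int _ R) => m Rm; rewrite vR // linear0 mulr0.
rewrite vertexUE [LHS]linearD /= (hbE l) (hbE (l - 1)) -(fsumD (fb l)) //.
apply: eq_fsbigr => m _; rewrite -mulrDl /hcol.
by congr ((hbar _ + hbar _) * _); lia.
Qed.

(** Stated for arbitrary integer indices, since [theta] applies the induction hypothesis to lowered
    ones. *)
Lemma so_functional_det n ls : size ls = n -> so_functional x alpha (so_vec ls) =
  \det (\matrix_(i < n, j < n) hcol hbar j (nth 0 ls i - i%:Z)).
Proof.
elim: n ls => [|n IHn] [|l ls] //= => [_|[lsn]].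
  by rewrite det_mx00 so_functional_vac.
rewrite so_functional_vertexU pair_bmode.
pose g (i j : 'I_n) (t : int) : {poly K} := (hcol hbar j (t - i%:Z))%:P.
have -> : theta (fun s => (so_functional x alpha (so_vec s))%:P) ls =
          theta (fun s => \det (\matrix_(i, j) g i j (nth 0 s i))) ls.
  apply: eq_theta => s sls; rewrite IHn ?sls // -det_map_mx; congr (\det _).
  by apply/matrixP => i j; rewrite !mxE.
rewrite theta_det //.
pose c (i : 'I_n) (j : nat) : {poly K} := (hcol hbar j (nth 0 ls i - i.+1%:Z))%:P.
transitivity (laurent_pair (fun m => hcol hbar 0 (l - m))
   (\det (\matrix_(i < n, j < n) (c i j.+1 - 'X * c i j + c i j.-1)))).
  congr (laurent_pair _ (\det _)); apply/matrixP => i j; rewrite !mxE /theta1 /g /c.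
  (* Row i of the smaller determinant becomes row i + 1 of the larger one, hence [i.+1]; by
     [hcol_rec], the values at t + 1 and t - 1 give the neighbouring columns at t. *)
  set t := nth 0 ls i - i.+1%:Z.
  have -> : nth 0 ls i - i%:Z = t + 1 by rewrite /t; lia.
  have -> : nth 0 ls i - 1 - i%:Z = t by rewrite /t; lia.
  have -> : nth 0 ls i - 2 - i%:Z = t - 1 by rewrite /t; lia.
  by rewrite addrAC -polyCD hcol_rec polyCD [RHS]addrAC.
(* Both determinants are expanded along the first row. The cofactors are constant, so the pairing
   only meets [fold_poly j] and turns it into [hcol j l]. *)
rewrite -det_fold_poly (expand_det_row _ ord0) linear_sum [RHS](expand_det_row _ ord0).
apply: eq_bigr => j _; set A := \matrix_(i, j) _; set B := \matrix_(i, j) _.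
have -> : cofactor A ord0 j = (cofactor B ord0 j)%:P.
  rewrite /cofactor rmorphM rmorphXn rmorphN rmorph1 -det_map_mx; congr (_ * \det _).
  by apply/matrixP => i k; rewrite !mxE liftK.
rewrite /A /B !mxE unlift_none subr0 mulrC mul_polyC linearZ_LR /= fold_poly_hcol.
exact: mulrC.
Qed.

End JacobiTrudi.

Theorem theorem4p3 (K : fieldType) (charK : [pchar K] =i pred0)
    (M : fockSpace K) (N : nat) (N_gt0 : (0 < N)%N)
    (lambda : N.-tuple nat) (lambda_part : sorted geq lambda)
    (x : 'I_N -> K) (x_neq0 : forall i, x i != 0) (alpha : K)
    (hbar : int -> K) (hbarP : is_hbar x alpha hbar) :
  sBD M lambda x alpha =
  \det (\matrix_(i < N, j < N)
    (let l := (tnth lambda i)%:Z in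
     let i1 := i.+1%:Z in
     let j1 := j.+1%:Z in
     hbar (l - i1 + j1) + hbar (l - i1 - j1 + 1))).
Proof.
have -> : sBD M lambda x alpha = so_functional x alpha (so_vec M (map Posz lambda)).
  congr (dvac M (Gamma_pm x (Gamma_inv alpha _))).
  (* U_(-k) is the coefficient of z^k in U(z). *)
  by elim: (tval lambda) => //= k s ->; rewrite /Umode opprK.
rewrite (@so_functional_det _ charK M _ _ _ _ hbarP N) ?size_map ?size_tuple //.
(* Only the passage from indices counted from 0 to indices counted from 1 remains. *)
congr (\det _); apply/matrixP => i j; rewrite !mxE /hcol (nth_map 0) ?size_tuple //.
rewrite -tnth_nth; move: (tnth lambda i : nat) => l.
by congr (hbar _ + hbar _); lia.
Qed.
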